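(* Let $n,r\ge 1$, and let $0<k\le n$. Then $$d\,\mathcal{S}_{r+1}\Lambda^{k-1}(\mathbb{R}^n)\subset\mathcal{S}_r\Lambda^k(\mathbb{R}^n).$$
   Context: Let $\mathbb{N}_n=\{1,\dots,n\}$. For $\sigma=\{\sigma_1<\dots<\sigma_k\}\subset\mathbb{N}_n$ put $dx_\sigma=dx_{\sigma_1}\wedge\dots\wedge dx_{\sigma_k}$ and $\sigma^*=\mathbb{N}_n\setminus\sigma$. A $k$-form monomial is $m=x^\alpha\,dx_\sigma$ with $\alpha$ a multi-index and $\#\sigma=k$; set $\deg m=\sum_i\alpha_i$ and $\operatorname{ldeg} m=\#\{i\in\sigma^*: \alpha_i=1\}$. $\mathcal{P}_r\Lambda^k(\mathbb{R}^n)$ and $\mathcal{H}_r\Lambda^k(\mathbb{R}^n)$ are the spans of the $k$-form monomials of degree $\le r$, respectively $=r$. The linear degree $\operatorname{ldeg}$ of a polynomial form is the minimum of $\operatorname{ldeg} m$ over its monomials (the zero form counts as having linear degree at least $l$ for every $l$), and $\mathcal{H}_{r,l}\Lambda^k(\mathbb{R}^n)$ is the space of $\omega\in\mathcal{H}_r\Lambda^k(\mathbb{R}^n)$ with $\operatorname{ldeg}\omega\ge l$. Spaces of $k$-forms with $k>n$ or $k<0$ are zero. Koszul differential: $\kappa\bigl(\sum_\sigma\omega_\sigma\,dx_\sigma\bigr)=\sum_\sigma\omega_\sigma\sum_{i=1}^k(-1)^{i+1}x_{\sigma_i}\,dx_{\sigma_1}\wedge\dots\wedge\widehat{dx_{\sigma_i}}\wedge\dots\wedge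 dx_{\sigma_k}$ (zero on $0$-forms). $d$ is the exterior derivative. $\mathcal{J}_r\Lambda^k(\mathbb{R}^n)=\sum_{l\ge1}\kappa\,\mathcal{H}_{r+l-1,l}\Lambda^{k+1}(\mathbb{R}^n)$ and, for $r\ge 1$, $0\le k\le n$, $\mathcal{S}_r\Lambda^k(\mathbb{R}^n)=\mathcal{P}_r\Lambda^k(\mathbb{R}^n)+\mathcal{J}_r\Lambda^k(\mathbb{R}^n)+d\mathcal{J}_{r+1}\Lambda^{k-1}(\mathbb{R}^n)$. *)

(* Defs.v *)
From mathcomp Require Import all_boot all_order all_algebra.
From mathcomp Require Import classical_sets reals.
From mathcomp Require Import mpoly.

Set Implicit Arguments.
Unset Strict Implicit.
Unset Printing Implicit Defensive.

Import GRing.Theory.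

Local Open Scope ring_scope.
Local Open Scope classical_set_scope.

(* The coordinates are indexed by 'I_n = {0, ..., n-1}.  A polynomial          *)
(* differential form of arbitrary (mixed) degree is identified with the family *)
(* of its coefficients, w s being the coefficient of dx_s; the forms of a given *)
(* degree k are carved out by the spaces defined below.                        *)
Notation polyform R n := {ffun {set 'I_n} -> {mpoly R[n]}}.

Section Forms.
Variables (R : nzRingType) (n : nat).
Implicit Types (a : 'X_{1..n}) (s : {set 'I_n}) (p : {mpoly R[n]}).
Implicit Types (w : polyform R n).

(* p dx_s *)
Definition dxform p s : polyform R n := [ffun t => if t == s then p else 0].

(* x^a dx_s *)
Definition form_monomial a s : polyform R n := dxform 'X_[a] s.

Definition monomial_ldeg a s : nat := #|[set i in (~: s)%SET | a i == 1%N]%SET|.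

(* The minimum of the linear degrees of the monomials of w.  Every monomial has *)
(* linear degree at most n, so the initial value n of the iterated minimum is   *)
(* irrelevant as soon as w has a monomial, i.e. w <> 0.                         *)
Definition form_ldeg w : nat :=
  \big[minn/n]_(s : {set 'I_n}) \big[minn/n]_(a <- msupp (w s))
    monomial_ldeg a s.

(* (-1)^#{j in s, j < i}: for s = {s_1 < ... < s_k} and i = s_j this is         *)
(* (-1)^(j+1); for i not in s, dx_i /\ dx_s = form_sign i s dx_(i |: s).        *)
Definition form_sign (i : 'I_n) s : R :=
  (-1) ^+ #|[set j in s | (j < i)%N]%SET|.

Definition koszul w : polyform R n :=
  \sum_(s : {set 'I_n}) \sum_(i in s)
    form_sign i s *: dxform (w s * 'X_i) (s :\ i)%SET.

Definition extd w : polyform R n :=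
  \sum_(s : {set 'I_n}) \sum_(i in (~: s)%SET)
    form_sign i s *: dxform (mderiv i (w s)) (i |: s)%SET.

Definition lspan (A : set (polyform R n)) : set (polyform R n) :=
  [set w | exists2 c : seq (R * polyform R n),
     (forall u, u \in c -> A u.2) & w = \sum_(u <- c) u.1 *: u.2].

Definition sum_space (U V : set (polyform R n)) : set (polyform R n) :=
  [set w | exists u v, [/\ U u, V v & w = u + v]].

(* The sum of the subspaces V l, l >= 1. *)
Definition sum_spaces_ge1 (V : nat -> set (polyform R n)) :
    set (polyform R n) :=
  [set w | exists (N : nat) (f : nat -> polyform R n),
     (forall l : nat, (1 <= l < N)%N -> V l (f l)) /\
     w = \sum_(1 <= l < N) f l].

(* The form degree k is an integer: all the spaces below are zero when k < 0    *)
(* or k > n, as there are then no k-form monomials and koszul kills 0-forms.    *)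
Implicit Types (r l : nat) (k : int).

Definition Pspace r k : set (polyform R n) :=
  lspan [set m | exists a s,
    [/\ #|s|%:Z = k, (mdeg a <= r)%N & m = form_monomial a s]].

Definition Hspace r k : set (polyform R n) :=
  lspan [set m | exists a s,
    [/\ #|s|%:Z = k, mdeg a = r & m = form_monomial a s]].

(* H_{r,l} Lambda^k *)
Definition Hlspace r l k : set (polyform R n) :=
  [set w | Hspace r k w /\ (w = 0 \/ (l <= form_ldeg w)%N)].

(* The truncated subtraction (r + l - 1)%N is only used for l >= 1. *)
Definition Jspace r k : set (polyform R n) :=
  sum_spaces_ge1 (fun l => koszul @` Hlspace (r + l - 1)%N l (k + 1)).

Definition Sspace r k : set (polyform R n) :=
  sum_space (sum_space (Pspace r k) (Jspace r k))
            (extd @` Jspace r.+1 (k - 1)).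

End Forms.

(* Main.v *)
(** Exterior differentiation lowers the polynomial degree by one, so it maps
    the full polynomial part of the source into the full polynomial part of the
    target; it maps the summand J of the source onto the summand dJ of the
    target (the indices agree); and it kills the summand dJ of the source
    because d o d = 0. *)
Require Import Defs.
From HB Require Import structures.
From mathcomp Require Import all_boot all_order all_algebra.
From mathcomp Require Import classical_sets reals.
From mathcomp Require Import mpoly.

Import GRing.Theory.

Local Open Scope ring_scope.
Local Open Scope classical_set_scope.

(** Off the diagonal, the terms at [(i, j)] and [(j, i)] cancel in pairs. The diagonal has its own
    hypothesis because [x = - x] does not force [x = 0] in a general [zmodType]. *)
Lemma sum_antisymmetric (V : zmodType) (n : nat) (F : 'I_n -> 'I_n -> V) :
  (forall i, F i i = 0) -> (forall i j, i != j -> F j i = - F i j) ->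
  \sum_i \sum_j F i j = 0.
Proof.
move=> F0 Fanti.
have split_row i : \sum_j F i j =
    \sum_(j : 'I_n | (i < j)%N) F i j + \sum_(j : 'I_n | (j < i)%N) F i j.
  rewrite (bigID (fun j : 'I_n => (i < j)%N)) /=; congr (_ + _).
  rewrite (bigD1 i) ?ltnn //= F0 add0r; apply: eq_bigl => j.
  by rewrite -leqNgt andbC -(inj_eq val_inj) -ltn_neqAle.
under eq_bigr => i _ do rewrite split_row.
(* Transposing the lower triangle puts both halves over the pairs with [i < j]. *)
rewrite big_split /= [X in _ + X](exchange_big_dep xpredT) //= -big_split /=.
rewrite big1 // => i _; rewrite -big_split big1 //= => j ltij.
by rewrite (Fanti i j) ?subrr // -(inj_eq val_inj) neq_ltn ltij.
Qed.

Section ExteriorDerivative.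
Variables (R : comNzRingType) (n : nat).
Implicit Types (p q : {mpoly R[n]}) (s : {set 'I_n}) (w : polyform R n).

(* Unqualified, [form_sign] is a constant of MathComp's sesquilinear forms. *)
Local Notation sgn := (Defs.form_sign R).

Lemma dxform_is_linear s : linear (fun p => dxform p s).
Proof.
move=> c p q; apply/ffunP => t; rewrite !ffunE.
by case: eqP => // _; rewrite scaler0 addr0.
Qed.

Lemma dxform0 s : dxform (0 : {mpoly R[n]}) s = 0.
Proof. by apply/ffunP => t; rewrite !ffunE; case: ifP. Qed.

Lemma dxformZ c p s : dxform (c *: p) s = c *: dxform p s.
Proof. by rewrite -[c *: p]addr0 dxform_is_linear dxform0 addr0. Qed.

Lemma extd_is_linear : linear (@extd R n).
Proof.
move=> c u v; rewrite /extd scaler_sumr -big_split /=; apply: eq_bigr => s _.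
rewrite scaler_sumr -big_split /=; apply: eq_bigr => i _.
by rewrite !ffunE linearP dxform_is_linear scalerDr !scalerA mulrC.
Qed.

HB.instance Definition _ :=
  GRing.isLinear.Build R (polyform R n) (polyform R n) _
    (@extd R n) extd_is_linear.

Lemma extd_dxform p s :
  extd (dxform p s) =
  \sum_(i in (~: s)%SET) sgn i s *: dxform (mderiv i p) (i |: s)%SET.
Proof.
rewrite /extd (bigD1 s) //= [X in _ + X]big1 ?addr0 => [|t /negPf neq_ts].
  by apply: eq_bigr => i _; rewrite ffunE eqxx.
by apply: big1 => i _; rewrite ffunE neq_ts mderiv0 dxform0 scaler0.
Qed.

Lemma extdE w : extd w = \sum_s extd (dxform (w s) s).
Proof. by apply: eq_bigr => s _; rewrite extd_dxform. Qed.

(** The new element [i] is counted below [j] exactly when [i < j]. *)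
Lemma form_signU1 (i j : 'I_n) s :
  i \notin s -> sgn j (i |: s)%SET = (-1) ^+ (i < j)%N * sgn j s.
Proof.
move=> notin_is; rewrite /Defs.form_sign -exprD; congr (_ ^+ _).
case: (ltnP i j) => [lt_ij|le_ji].
  have -> : [set l in (i |: s) | (l < j)%N]%SET
      = (i |: [set l in s | (l < j)%N])%SET.
    by apply/setP => l; rewrite !inE; case: eqP => // ->; rewrite lt_ij.
  by rewrite cardsU1 inE (negPf notin_is).
apply: eq_card => l; rewrite !inE; case: eqP => // ->.
by rewrite ltnNge le_ji (negPf notin_is).
Qed.

Lemma extd_extd w : extd (extd w) = 0.
Proof.
rewrite (extdE w) linear_sum big1 // => s _.
rewrite extd_dxform linear_sum /=.
(* Extending the double sum by zero to all pairs makes its index set symmetric; the guard on [j]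
   excludes [j = i], so the diagonal vanishes. *)
pose F (i j : 'I_n) : polyform R n :=
  if (i \in (~: s)%SET) && (j \in (~: (i |: s))%SET) then
    sgn i s *: (sgn j (i |: s)%SET *:
      dxform (mderiv j (mderiv i (w s))) (j |: (i |: s))%SET)
  else 0.
transitivity (\sum_i \sum_j F i j).
  rewrite big_mkcond; apply: eq_bigr => i _; rewrite /F.
  case: ifP => _ /=; last by rewrite big1.
  by rewrite linearZ /= extd_dxform scaler_sumr big_mkcond.
apply: sum_antisymmetric => [i|i j neq_ij]; rewrite /F !inE ?eqxx ?andbF //.
rewrite [j == i]eq_sym (negPf neq_ij) /= andbC.
case: ifP => [/andP[notin_is notin_js]|_]; last by rewrite oppr0.
rewrite !form_signU1 // !scalerA -scaleNr mderiv_comm finset.setUCA.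
congr (_ *: _).
(* Mixed partials and the target [dx] agree by now, so only signs remain; for [i != j] exactly one
   of [i < j] and [j < i] holds. *)
have -> : (-1) ^+ (j < i)%N = - (-1) ^+ (i < j)%N :> R.
  by move: neq_ij; rewrite -(inj_eq val_inj); case: ltngtP; rewrite ?opprK.
by rewrite mulNr mulrN mulrCA [in RHS]mulrCA (mulrC (sgn j s)).
Qed.

(** The lists witnessing the summands are rescaled and concatenated. *)
Lemma lspan_comb (A : set (polyform R n)) (I : Type) (s : seq I) (P : pred I)
    (c : I -> R) (F : I -> polyform R n) :
  (forall i, P i -> lspan A (F i)) -> lspan A (\sum_(i <- s | P i) c i *: F i).
Proof.
move=> AF; elim/big_rec: _ => [|i _ /AF[e Ae ->] [f Af ->]].
  by exists [::] => //; rewrite big_nil.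
exists ([seq (c i * u.1, u.2) | u <- e] ++ f).
  by move=> u; rewrite mem_cat => /orP[/mapP[v /Ae ? ->]|/Af].
rewrite big_cat big_map scaler_sumr; congr (_ + _).
by apply: eq_bigr => u _; rewrite scalerA.
Qed.

Lemma extd_monomial_Pspace r (k : int) (a : 'X_{1..n}) s :
  #|s|%:Z = k - 1 -> (mdeg a <= r.+1)%N ->
  Pspace r k (extd (form_monomial R a s)).
Proof.
move=> cards dega; rewrite extd_dxform; apply: lspan_comb => i.
rewrite inE => notin_is; rewrite mderivX dxformZ.
(* If [a i = 0], truncated subtraction gives [a - U_(i) = a], whose degree may still be [r.+1]; the
   derivative is then zero and the empty combination serves. *)
have [->|ai0] := eqVneq (a i) 0%N.
  by exists [::] => //; rewrite scale0r big_nil.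
exists [:: ((a i)%:R, form_monomial R (a - U_(i)) (i |: s)%SET)].
  move=> u; rewrite inE => /eqP ->; exists (a - U_(i))%MM, (i |: s)%SET.
  split=> //.
    by rewrite cardsU1 notin_is PoszD cards addrC subrK.
  have le_ia : (U_(i) <= a)%MM by rewrite lep1mP.
  by move: dega; rewrite -{1}(submK le_ia) mdegD mdeg1 addn1.
by rewrite big_seq1.
Qed.

Lemma extd_Pspace r (k : int) w : Pspace r.+1 (k - 1) w -> Pspace r k (extd w).
Proof.
move=> [c Ac ->]; rewrite linear_sum /= big_seq.
under eq_bigr => u _ do rewrite linearZ /=.
apply: lspan_comb => u /Ac[a [s [cards dega ->]]].
exact: extd_monomial_Pspace.
Qed.

Lemma Jspace0 r (k : int) : Jspace r k (0 : polyform R n).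
Proof. by exists 0%N, (fun=> 0); split=> [l|]; rewrite ?andbF ?big_geq. Qed.

End ExteriorDerivative.

Theorem theorem3p3 (R : realType) (n r : nat) (k : int)
    (hn : (1 <= n)%N) (hr : (1 <= r)%N) (hk0 : 0 < k) (hkn : k <= n%:Z) :
  @extd R n @` @Sspace R n r.+1 (k - 1) `<=` @Sspace R n r k.
Proof.
move=> _ [_ [_ [_ [[p [j [Pp Jj ->]]] [j' _ <-] ->]]] <-].
rewrite !linearD /= extd_extd addr0.
(* [Jspace r.+1 (k - 1)] occurs verbatim in both spaces, so [extd j] fills the last summand; the
   J-part of the image is taken to be [0]. *)
exists (extd p), (extd j); split=> //.
exists (extd p), 0; split; first exact: extd_Pspace.
- exact: Jspace0.
- by rewrite addr0.
Qed.
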